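(* Let $k\ge 1$, $m\ge 1$ and $0<r\le m$ be integers with $\gcd(r,m)=1$, and let $n$ be a natural number. If $n\not\equiv rk\pmod m$, then $s_{r,m,k}(n)=0$. Otherwise $n\equiv rk\pmod m$ and $$s_{r,m,k}(n)=\binom{\frac{n-rk}{m}+k-1}{k-1}.$$
   Context: Natural numbers are positive integers. A composition of a natural number $n$ into exactly $k$ parts is an ordered sequence $(a_1,\dots,a_k)$ of natural numbers (called its parts) with $n=a_1+a_2+\cdots+a_k$; sequences differing in order are different compositions. For a natural number $n$, $s_{r,m,k}(n)$ denotes the number of compositions of $n$ into exactly $k$ parts, all of which are congruent to $r$ modulo $m$. Binomial coefficients $\binom{a}{b}$ with integers $0\le a<b$ are equal to $0$. Here $\frac{n-rk}{m}$ is an integer, possibly negative. *)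

(* Defs.v *)
From mathcomp Require Import all_boot all_order all_algebra.
Set Implicit Arguments.
Unset Strict Implicit.
Unset Printing Implicit Defensive.

Definition is_composition (n k : nat) (a : seq nat) : bool :=
  [&& size a == k, all (fun x => 0 < x) a & sumn a == n].

Definition parts_congruent (r m : nat) (a : seq nat) : bool :=
  all (fun x => x == r %[mod m]) a.

(* The parts of a composition of n are at most n, so taking the entries in
   'I_n.+1 makes the count finite without losing any composition: see
   compositions_bounded. *)
Definition num_compositions (r m k n : nat) : nat :=
  #|[set a : k.-tuple 'I_n.+1 |
      is_composition n k (map val a) && parts_congruent r m (map val a)]|.

Lemma compositions_bounded (n k : nat) (a : seq nat) :
  is_composition n k a -> exists! t : k.-tuple 'I_n.+1, map val t = a.
Proof.
case/and3P=> /eqP sz _ /eqP sum.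
have mem_le x : x \in a -> x <= n.
  move=> xa; rewrite -sum -[sumn a]/(foldr addn 0 a).
  elim: a xa {sz sum} => //= y a IH; rewrite inE => /orP[/eqP->|/IH].
    exact: leq_addr.
  by move=> h; apply: leq_trans h _; apply: leq_addl.
have szt : size (map (@inord n) a) == k by rewrite size_map sz.
have valt : map val (Tuple szt) = a.
  rewrite /= -map_comp -[RHS]map_id; apply/eq_in_map => x xa /=.
  by rewrite inordK // ltnS mem_le.
exists (Tuple szt); split=> // t ht.
by apply/val_inj/(inj_map val_inj); rewrite ht; exact: valt.
Qed.

(* Binomial coefficient with integer upper index a: the value of
   a (a - 1) ... (a - b + 1) / b!. For a = n >= 0 it is 'C(n, b), hence 0 when
   0 <= a < b; Negz n is - (n + 1). *)
Definition binz (a : int) (b : nat) : int :=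
  match a with
  | Posz n => Posz 'C(n, b)
  | Negz n => ((-1) ^+ b * Posz 'C(n + b, b))%R
  end.

(* Main.v *)
Require Import Defs.
From mathcomp Require Import all_boot all_order all_algebra.
From mathcomp Require Import zify.

(** Every part is at least [r], so it is [r + m b] for a unique [b >= 0]. Hence
    the compositions counted correspond to the [k]-tuples [b] of nonnegative
    integers with [n = r k + m (b_1 + ... + b_k)], which stars and bars counts.
    When [n < r k] there are none, and the binomial vanishes because
    [(n - r k) / m + k - 1] is still nonnegative, as [0 < n] and [r <= m]. *)

Lemma leq_mem_sumn (s : seq nat) (x : nat) : x \in s -> x <= sumn s.
Proof. by move=> /perm_to_rem/perm_sumn->; apply: leq_addr. Qed.

Lemma sumn_map_affine (r m : nat) (s : seq nat) :
  sumn [seq r + m * x | x <- s] = r * size s + m * sumn s.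
Proof. by elim: s => [|x s /= ->]; rewrite ?muln0 // mulnS mulnDr addnACA. Qed.

(** Since [0 < x] and [r <= m], a value [x < r] would be a positive residue below [m] other than
    that of [r]. *)
Lemma modn_eq_affine (r m x : nat) : 0 < x -> r <= m -> x = r %[mod m] ->
  x = r + m * ((x - r) %/ m).
Proof.
move=> x0 rm xr; have rx : r <= x.
  have [ltxr|//] := ltnP x r; have ltxm := leq_trans ltxr rm.
  (* When [r = m] the residue of [r] is [0] rather than [r], and the contradiction is [x = 0]. *)
  move: rm; rewrite leq_eqVlt => /predU1P[rm|rm].
    by move: xr x0; rewrite rm modnn modn_small // => ->.
  by move: ltxr; rewrite -(modn_small ltxm) xr modn_small // ltnn.
have dv : m %| x - r by rewrite -eqn_mod_dvd //; apply/eqP.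
by rewrite [m * _]mulnC divnK // subnKC.
Qed.

Lemma congruent_compositionP (r m k n : nat) (a : seq nat) :
  0 < r -> r <= m ->
  reflect (exists b, [/\ a = [seq r + m * x | x <- b], size b = k
                       & n = r * k + m * sumn b])
          (is_composition n k a && parts_congruent r m a).
Proof.
move=> r0 rm; apply: (iffP idP) => [/andP[]|[b [-> sz ->]]].
  case/and3P=> /eqP sz /allP pos /eqP sum /allP cong.
  have aE : a = [seq r + m * x | x <- [seq (x - r) %/ m | x <- a]].
    rewrite -map_comp -[LHS]map_id; apply/eq_in_map => x xa.
    by apply: modn_eq_affine rm _; [apply: pos | apply/eqP/cong].
  exists [seq (x - r) %/ m | x <- a]; split=> //; first by rewrite size_map.
  by rewrite -sum {1}aE sumn_map_affine size_map sz.
rewrite /is_composition /parts_congruent size_map sz sumn_map_affine sz !eqxx.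
rewrite !all_map andbT; apply/andP; split; apply/allP => x _ /=.
  by rewrite addn_gt0 r0.
by rewrite addnC mulnC modnMDl.
Qed.

(** This covers both ways to have no composition: [n] in the wrong residue class, or [n] congruent
    to [r * k] but smaller. *)
Lemma num_compositions_eq0 (r m k n : nat) : 0 < r -> r <= m ->
  (forall q, n <> r * k + m * q) -> num_compositions r m k n = 0.
Proof.
move=> r0 rm nE; apply/eqP; rewrite cards_eq0; apply/eqP/setP=> t.
by rewrite !inE; apply/(congruent_compositionP _ _ _ _ _ r0 rm) => -[b [_ _ /nE]].
Qed.

(** Stars and bars is [card_ord_partitions], which counts [k.+1]-tuples over ['I_q.+1] with sum [q].
    Applying [r + m * x] entrywise maps these bijectively onto the compositions counted. *)
Lemma num_compositions_bin (r m k q : nat) : 0 < r -> r <= m ->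
  num_compositions r m k.+1 (r * k.+1 + m * q) = 'C(q + k, k).
Proof.
move=> r0 rm; have m0 := leq_trans r0 rm.
rewrite [q + k]addnC -card_ord_partitions /num_compositions.
set n := r * k.+1 + m * q.
have bound x : x <= q -> r + m * x <= n.
  by move=> xq; rewrite leq_add ?leq_pmulr // leq_mul2l xq orbT.
(* By [bound], [inord] never falls back to its default value here. *)
pose f (x : 'I_q.+1) : 'I_n.+1 := inord (r + m * x).
have fE x : f x = r + m * x :> nat by rewrite inordK // ltnS bound // -ltnS.
have f_inj : injective f.
  move=> x y /(congr1 val) /eqP /=; rewrite !fE eqn_add2l eqn_pmul2l //.
  by move/eqP/val_inj.
have map_f (t : seq 'I_q.+1) :
    map val (map f t) = [seq r + m * x | x <- map val t].
  by rewrite -!map_comp; apply: eq_map => x /=; rewrite fE.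
have map_tuple_inj : injective (map_tuple f : k.+1.-tuple _ -> k.+1.-tuple _).
  by move=> s t /(congr1 val) /= /(inj_map f_inj) /val_inj.
rewrite -(card_imset _ map_tuple_inj); congr #|pred_of_set _|; apply/setP => t.
rewrite inE; apply/(congruent_compositionP _ _ _ _ _ r0 rm)/imsetP.
  case=> b [tE sz /eqP]; rewrite eqn_add2l eqn_pmul2l // => /eqP sum.
  (* Entries of [b] are at most their sum [q], so they fit in ['I_q.+1]. *)
  have szb : size (map (@inord q) b) == k.+1 by rewrite size_map sz.
  have valb : map val (Tuple szb) = b.
    rewrite /= -map_comp -[RHS]map_id; apply/eq_in_map => x xb /=.
    by rewrite inordK // ltnS sum leq_mem_sumn.
  exists (Tuple szb).
    by rewrite inE -(big_map val xpredT id) valb -sumnE sum.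
  by apply/val_inj/(inj_map val_inj); rewrite [RHS]map_f valb.
case=> s; rewrite inE -(big_map val xpredT id) -sumnE => /eqP sum ->.
exists (map val s); split; [exact: map_f | by rewrite size_map size_tuple |].
by rewrite sum.
Qed.

Theorem theorem5 (k m r n : nat) (hk : 1 <= k) (hm : 1 <= m)
    (hr0 : 0 < r) (hrm : r <= m) (hgcd : gcdn r m = 1) (hn : 0 < n) :
  (n <> r * k %[mod m] -> num_compositions r m k n = 0)
  /\
  (n = r * k %[mod m] ->
     Posz (num_compositions r m k n) =
     binz (((n%:Z - (r * k)%N%:Z) %/ m%:Z)%Z + k%:Z - 1)%R (k - 1)).
Proof.
split=> [ncong | cong].
  apply: num_compositions_eq0 => // q nE; apply: ncong.
  by rewrite nE addnC mulnC modnMDl.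
case: k hk cong => // k _ cong; rewrite subn1 /=.
have [le_rk_n | lt_n_rk] := leqP (r * k.+1) n.
  have dv : m %| n - r * k.+1 by rewrite -eqn_mod_dvd //; apply/eqP.
  have nE : n = r * k.+1 + m * ((n - r * k.+1) %/ m).
    by rewrite [m * _]mulnC divnK // subnKC.
  rewrite {1}nE num_compositions_bin // subzn // divz_nat.
  set q := _ %/ m; by have -> : (q%:Z + k.+1%:Z - 1 = (q + k)%N)%R by lia.
(* Now the quotient is [- d] with [d > 0], and no composition exists. *)
have dv : m %| r * k.+1 - n.
  by rewrite -eqn_mod_dvd ?(ltnW lt_n_rk) //; apply/eqP.
have rkE : r * k.+1 = n + m * ((r * k.+1 - n) %/ m).
  by rewrite [m * _]mulnC divnK // subnKC // ltnW.
rewrite num_compositions_eq0 //; last first.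
  by move=> q nE; move: lt_n_rk; rewrite nE; lia.
set d := _ %/ m in rkE.
have d0 : 0 < d by case: d rkE => // rkE; move: lt_n_rk; rewrite rkE; lia.
(* From [0 < n], [m * d < r * k.+1 <= m * k.+1]. So the upper index [k - d] is nonnegative, which
   selects the [Posz] branch of [binz]; it is below [k] as [0 < d]. *)
have dk : d <= k.
  rewrite -ltnS -(ltn_pmul2l hm); apply: (@leq_trans (r * k.+1)).
    by rewrite rkE; lia.
  by rewrite leq_mul2r hrm orbT.
have -> : (n%:Z - (r * k.+1)%N%:Z = (- d%:Z) * m%:Z)%R by rewrite rkE; lia.
rewrite mulzK; last by lia.
have -> : (- d%:Z + k.+1%:Z - 1 = (k - d)%N)%R by lia.
by rewrite /= bin_small //; lia.
Qed.
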